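(* Assume $\mu_k$ and $\psi(\overline z_k)$ are not simultaneously equal to zero. Then the function \[ S(q_k,p_{k+1})=q_k^\top p_{k+1}+\mathcal L(z_k,z_{k+1},\lambda_k,\mu_k) \] is a generating function which determines a symplectic transformation between the vertices $z_k$ and $z_{k+1}$ of a regularized DTH trajectory for $k=0,\dots,N-1$. Here \[ \mathcal L(z_k,z_{k+1},\lambda_k,\mu_k)=\mathcal A(z_k,z_{k+1})+\lambda_k\mathcal H(\overline z_k)+\mu_k\psi(\overline z_k), \] and the variables $q_{k+1}$, $p_k$, $\lambda_k$ and $\mu_k$ are determined by the regularized DTH equations \[ \Delta z_k=\lambda_kJ\mathcal H_z(\overline z_k)+\mu_kJ\psi_z(\overline z_k),\quad \mathcal H(\overline z_k)=0,\quad \psi(\overline z_k)\ge\psi_k\ (\text{or }\psi(\overline z_k)\le\psi_k), \] \[ \mu_k(\psi(\overline z_k)-\psi_k)=0,\quad \mu_k\le0\ (\text{or }\mu_k\ge0). \]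
   Context: Consider an $n$-degree of freedom Hamiltonian dynamical system with Hamiltonian function $H(t,q_1,\dots,q_n,p_1,\dots,p_n)$, where $t$ is time and $q_i,p_i$ are position and momentum coordinates. Extended phase space coordinates are $q=(q_1,\dots,q_n,t)^\top$, $p=(p_1,\dots,p_n,\wp)^\top$, where $\wp$ is the momentum conjugate to time, and $z=(q,p)^\top$. The extended-phase space Hamiltonian function is $\mathcal H(z)=\wp+H(t,q_1,\dots,q_n,p_1,\dots,p_n)$. $J=\begin{pmatrix}0&I\\-I&0\end{pmatrix}$ with $I$ the $(n+1)$-dimensional identity matrix; subscripts $z$ and $zz$ denote gradient and Hessian, and $\psi(z)=(J\mathcal H_z)^\top\mathcal H_{zz}(J\mathcal H_z)$. The $\psi_k$ are constants. Trajectories are piecewise-linear and continuous in extended phase space, with vertices $z_k=(q_k,p_k)^\top$, $k=0,\dots,N$. Write $\Delta z_k=z_{k+1}-z_k$, $\Delta q_k=q_{k+1}-q_k$, $\Delta p_k=p_{k+1}-p_k$ and $\overline z_k=\frac12(z_{k+1}+z_k)$. The one-step action is $\mathcal A(z_k,z_{k+1})=\frac12\Delta q_k^\top\Delta p_k$. A regularized DTH (discrete-time Hamiltonian) trajectory is one along which, for $k=0,\dots,N-1$, the one-step action $\mathcal A(z_k,z_{k+1})$ is stationary for variations which fix $q_k$ and $p_{k+1}$ and satisfy the Hamiltonian constraint $\mathcal H(\overline z_k)=0$ and the inequality constraint $\psi(\overline z_k)\ge\psi_k$ (or $\psi(\overline z_k)\le\psi_k$). In the equations, $\lambda_k$ is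 the Lagrange multiplier for the equality constraint and $\mu_k$ the Karush-Kuhn-Tucker multiplier for the inequality constraint; the alternatives in parentheses go together. That $S(q_k,p_{k+1})$ is a generating function for the transformation between $z_k$ and $z_{k+1}$ means $S_{q_k}(q_k,p_{k+1})=p_k$ and $S_{p_{k+1}}(q_k,p_{k+1})=q_{k+1}$.
   Formalization: The multiplier term is μ_k(ψ−ψ_k); the printed μ_kψ works iff ψ_k∇μ_k=0 (also proved). q_{k+1}, p_k are assumed C¹ functions of (q_k,p_{k+1}) solving the equations on an open set; the map z_k→z_{k+1} is asserted where z_k is a nonsingular function of (q_k,p_{k+1}). *)

(* Defs.v *)
From HB Require Import structures.
From mathcomp Require Export all_boot all_order all_algebra.
From mathcomp Require Export all_classical all_reals all_analysis.
Set Implicit Arguments.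
Unset Strict Implicit.
Unset Printing Implicit Defensive.
Import Order.TTheory GRing.Theory Num.Theory.
Import numFieldNormedType.Exports.
Local Open Scope classical_set_scope.
Local Open Scope ring_scope.

(* Points are column vectors, so that the matrix formulas have their usual
   shape; [jacobian] of mathcomp.analysis.derive acts on row vectors, whence the
   transposed version [jac]. *)

Section Calculus.
Context {R : realType}.

Definition partial m (i : 'I_m) (f : 'cV[R]_m -> R) : 'cV[R]_m -> R :=
  fun x => 'D_(delta_mx i 0) f x.

Definition grad m (f : 'cV[R]_m -> R) (x : 'cV[R]_m) : 'cV[R]_m :=
  \col_i partial i f x.

Definition hess m (f : 'cV[R]_m -> R) (x : 'cV[R]_m) : 'M[R]_m :=
  \matrix_(i, j) partial j (partial i f) x.

Definition jac m k (f : 'cV[R]_m -> 'cV[R]_k) (x : 'cV[R]_m) : 'M[R]_(k, m) :=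
  \matrix_(i, j) ('D_(delta_mx j 0) f x) i 0.

Fixpoint of_class_C m (r : nat) (f : 'cV[R]_m -> R) : Prop :=
  if r is s.+1 then
    (forall x, differentiable f x) /\ (forall i, of_class_C s (partial i f))
  else continuous f.

Definition C1_on m k (U : set 'cV[R]_m) (f : 'cV[R]_m -> 'cV[R]_k) : Prop :=
  forall x, U x -> differentiable f x /\ {for x, continuous (jac f)}.

Definition dot m (u v : 'cV[R]_m) : R := (u^T *m v) 0 0.

Definition Jmx m : 'M[R]_(m + m) := block_mx 0 1%:M (- 1%:M) 0.

Definition symplectic_mx m (M : 'M[R]_(m + m)) : Prop :=
  M^T *m Jmx m *m M = Jmx m.

End Calculus.

Section DiscreteTimeHamiltonian.
Context {R : realType}.

(* A point of extended phase space is z = (q_1..q_n, t, p_1..p_n, wp); the time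
   and its conjugate momentum wp are the last coordinates of the two halves. *)
Definition ext_ham n (H : R -> 'cV[R]_n -> 'cV[R]_n -> R)
    (z : 'cV[R]_(n.+1 + n.+1)) : R :=
  let q := usubmx z in
  let p := dsubmx z in
  p ord_max 0 + H (q ord_max 0)
                  (\col_(i < n) q (widen_ord (leqnSn n) i) 0)
                  (\col_(i < n) p (widen_ord (leqnSn n) i) 0).

Context {m : nat}.
Implicit Types (F : 'cV[R]_(m + m) -> R) (za zb : 'cV[R]_(m + m)).

Definition psi F (z : 'cV[R]_(m + m)) : R :=
  let X := Jmx m *m grad F z in (X^T *m hess F z *m X) 0 0.

Definition midpoint za zb : 'cV[R]_(m + m) := 2^-1 *: (zb + za).

Definition action za zb : R :=
  2^-1 * dot (usubmx (zb - za)) (dsubmx (zb - za)).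

(* The boolean selects between the two alternatives: [true] for
   psi >= c with mu <= 0, [false] for psi <= c with mu >= 0. *)
Definition psi_constraint (b : bool) F (c : R) (z : 'cV[R]_(m + m)) : Prop :=
  if b then c <= psi F z else psi F z <= c.

Definition mu_sign (b : bool) (mu : R) : Prop :=
  if b then mu <= 0 else 0 <= mu.

Definition admissible (b : bool) F (c : R) za zb : Prop :=
  F (midpoint za zb) = 0 /\ psi_constraint b F c (midpoint za zb).

(* The variations move p_a and q_b, along curves eps |-> (pa eps, qb eps), and
   leave q_a and p_b fixed. *)
Definition stationary_step (b : bool) F (c : R) za zb : Prop :=
  admissible b F c za zb /\
  forall pa qb : R -> 'cV[R]_m,
    let va e := col_mx (usubmx za) (pa e) in
    let vb e := col_mx (qb e) (dsubmx zb) in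
    va 0 = za -> vb 0 = zb ->
    derivable pa 0 1 -> derivable qb 0 1 ->
    (\forall e \near (0 : R), admissible b F c (va e) (vb e)) ->
    is_derive (0 : R) 1 (fun e => action (va e) (vb e)) 0.

Definition regularized_DTH_trajectory (b : nat -> bool) F (c : nat -> R)
    (N : nat) (z : nat -> 'cV[R]_(m + m)) : Prop :=
  forall k, (k < N)%N -> stationary_step (b k) F (c k) (z k) (z k.+1).

Definition regularized_DTH_eqs (b : bool) F (c : R) za zb (lam mu : R) : Prop :=
  [/\ zb - za = lam *: (Jmx m *m grad F (midpoint za zb))
                + mu *: (Jmx m *m grad (psi F) (midpoint za zb)),
      admissible b F c za zb,
      mu * (psi F (midpoint za zb) - c) = 0
    & mu_sign b mu].

(* The inequality constraint is psi - c >= 0 (or <= 0), so its multiplier term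
   is mu (psi - c).  Dropping the constant c does not change the equations at
   fixed multipliers, but it does change the function obtained by letting mu
   depend on (q_a, p_b). *)
Definition lagrangian F (c : R) za zb (lam mu : R) : R :=
  action za zb + lam * F (midpoint za zb)
  + mu * (psi F (midpoint za zb) - c).

(* In what follows x = (q_a, p_b), and P and Q give p_a and q_b in terms of x. *)
Definition start_vertex (P : 'cV[R]_(m + m) -> 'cV[R]_m) (x : 'cV[R]_(m + m))
  : 'cV[R]_(m + m) := col_mx (usubmx x) (P x).

Definition end_vertex (Q : 'cV[R]_(m + m) -> 'cV[R]_m) (x : 'cV[R]_(m + m))
  : 'cV[R]_(m + m) := col_mx (Q x) (dsubmx x).

Definition DTH_genfun F (c : R) (Q P : 'cV[R]_(m + m) -> 'cV[R]_m)
    (lam mu : 'cV[R]_(m + m) -> R) (x : 'cV[R]_(m + m)) : R :=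
  dot (usubmx x) (dsubmx x)
  + lagrangian F c (start_vertex P x) (end_vertex Q x) (lam x) (mu x).

Definition generating_function (U : set 'cV[R]_(m + m))
    (S : 'cV[R]_(m + m) -> R) (Q P : 'cV[R]_(m + m) -> 'cV[R]_m) : Prop :=
  forall x, U x ->
    [/\ differentiable S x,
        usubmx (grad S x) = P x
      & dsubmx (grad S x) = Q x].

(* dq_a /\ dp_a = dq_b /\ dp_b in the coordinates x; moreover, wherever z_a is a
   nonsingular function of x, the correspondence z_a |-> z_b is locally a map,
   whose Jacobian matrices are symplectic. *)
Definition symplectic_transformation (U : set 'cV[R]_(m + m))
    (Q P : 'cV[R]_(m + m) -> 'cV[R]_m) : Prop :=
  forall x, U x ->
    let A := jac (start_vertex P) x in
    let B := jac (end_vertex Q) x in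
    A^T *m Jmx m *m A = B^T *m Jmx m *m B /\
    (A \in unitmx ->
     exists Phi : 'cV[R]_(m + m) -> 'cV[R]_(m + m),
       (\forall y \near x, Phi (start_vertex P y) = end_vertex Q y) /\
       (\forall w \near start_vertex P x,
          differentiable Phi w /\ symplectic_mx (jac Phi w))).

End DiscreteTimeHamiltonian.

(* Main.v *)
(** Write x = (q_k, p_{k+1}). Along solutions of the regularized equations the
    constraint and complementarity conditions reduce S to
    q_k . p_{k+1} + action, which no longer involves the multipliers. Its
    variation is p_k . dq_k + q_{k+1} . dp_{k+1} minus the work
    lambda dH(zbar) + mu dpsi(zbar), and that work vanishes: H(zbar) is
    identically 0, and wherever mu <> 0 the inequality constraint is active, so
    that psi(zbar) has a local extremum there.
    Symplecticity is the symmetry of the second derivatives of S; where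
    x |-> z_k is nonsingular, the inverse function theorem turns the relation
    between z_k and z_{k+1} into a local map. *)
From HB Require Import structures.
From mathcomp Require Import ring lra.
Require Import Defs.
Import Order.TTheory GRing.Theory Num.Theory.
Import numFieldNormedType.Exports.
Local Open Scope classical_set_scope.
Local Open Scope ring_scope.

Set Implicit Arguments.
Unset Strict Implicit.
Unset Printing Implicit Defensive.

(** * Differentiation in normed modules *)

Section EpsilonDifferential.
Context {R : realType} {V W : normedModType R}.
Implicit Types (f g : V -> W) (x : V).

Lemma differentiable_near_le f x : differentiable f x ->
  forall e, 0 < e ->
    \forall y \near x, `|f y - f x - 'd f x (y - x)| <= e * `|y - x|.
Proof.
move=> [[_ /eqaddoP fE]] e /fE.
have -> : lim (nbhs_filter_on x) = x by exact: lim_id.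
by apply: filterS => y; rewrite !fctE/= opprD addrA.
Qed.

(** Converse of the preceding estimate: first-order approximation by a continuous linear map both
    gives differentiability and, by uniqueness, identifies the differential. *)
Lemma differentiable_of_near_le f (df : {linear V -> W}) x : continuous df ->
  (forall e, 0 < e ->
    \forall y \near x, `|f y - f x - df (y - x)| <= e * `|y - x|) ->
  differentiable f x /\ 'd f x = df :> (V -> W).
Proof.
move=> dfc fle.
have fo : f \o shift x = cst (f x) + df +o_ 0 id.
  apply/eqaddoP => e e0; have := fle _ e0; rewrite (near_shift 0) subr0.
  apply: filterS => h /=; rewrite addrK !fctE /=.
  by rewrite opprD addrA.
have dE : 'd f x = df :> (V -> W) by exact: diff_unique.
split=> //; apply/diff_locallyP; split; first by rewrite dE.
by rewrite dE.
Qed.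

Lemma near_eq_differentiable f g x :
  (\forall y \near x, f y = g y) -> differentiable f x -> differentiable g x.
Proof.
move=> fg df; apply: (proj1 (differentiable_of_near_le (df := 'd f x) _ _)).
  exact: diff_continuous.
move=> e e0; have fgx := nbhs_singleton fg.
apply: filterS2 (differentiable_near_le df e0) fg => y fy <-.
by rewrite -fgx.
Qed.

End EpsilonDifferential.

(** * Symmetry of mixed second derivatives *)

Section Schwarz.
Context {R : realType} {V : normedModType R}.
Implicit Types (f : V -> R) (x u v : V).

Lemma is_derive_line f x u (s : R) : differentiable f (x + s *: u) ->
  is_derive s 1 (fun t => f (x + t *: u)) ('D_u f (x + s *: u)).
Proof.
move=> df; have dl : is_diff s (fun t : R => x + t *: u) (fun t => t *: u).
  by apply: is_diff_eq; rewrite add0r.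
have dfl : is_diff s (f \o (fun t : R => x + t *: u))
    ('d f (x + s *: u) \o (fun t => t *: u)).
  by apply: is_diff_comp; apply: differentiableP.
apply: DeriveDef; first exact/derivable1_diffP.
by rewrite deriveE//= diff_val /= scale1r deriveE.
Qed.

(** The mean value theorem in direction [u] turns the second difference into [t] times a difference
    of values of ['D_u f]. Differentiability of ['D_u f] at the single point [x] then evaluates that
    difference up to o(t). *)
Lemma second_difference_le f x u v :
  (\forall y \near x, differentiable f y) -> differentiable ('D_u f) x ->
  forall e, 0 < e -> \forall t \near 0^'+,
    `|f (x + t *: u + t *: v) - f (x + t *: u) - f (x + t *: v) + f x
      - t ^+ 2 * 'D_v ('D_u f) x| <= e * t ^+ 2.
Proof.
move=> df da e e0; set a := 'D_u f; set K := `|u| + `|v| + 1.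
have K0 : 0 < K by rewrite ltr_wpDl// addr_ge0.
(* All points used lie within [t * K] of [x], so each of the two expansions of ['D_u f] costs
   [e / (2 * K) * (t * K)], half of [e * t]. *)
have e'0 : 0 < e / (2 * K) by rewrite divr_gt0// mulr_gt0.
have [r /= r0 fr] :=
  (nbhs_normP _ _).1 (filterI df (differentiable_near_le da e'0)).
near=> t.
have t0 : 0 < t by near: t; exact: nbhs_right_gt.
have tr : t * K < r.
  by rewrite -ltr_pdivlMr//; near: t; apply: nbhs_right_lt; rewrite divr_gt0.
have subE c d : x + c *: u + d *: v - x = c *: u + d *: v.
  by rewrite addrC !addrA addNr add0r.
have close c d : 0 <= c <= t -> 0 <= d <= t ->
    `|x + c *: u + d *: v - x| <= t * K.
  move=> /andP[c0 ct] /andP[d0 dt]; rewrite subE.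
  rewrite (le_trans (ler_normD _ _))// !normrZ !ger0_norm// /K.
  have ? := normr_ge0 u; have ? := normr_ge0 v; nra.
have rangeP c d : 0 <= c <= t -> 0 <= d <= t ->
    differentiable f (x + c *: u + d *: v) /\
    `|a (x + c *: u + d *: v) - a x - 'd a x (c *: u + d *: v)| <=
      e / (2 * K) * (t * K).
  move=> ct dt; have cl := close _ _ ct dt.
  have [|dfc] := fr (x + c *: u + d *: v).
    by rewrite /= distrC (le_lt_trans cl).
  rewrite subE in cl *; move=> le1; split=> //; apply: (le_trans le1).
  by rewrite ler_wpM2l// (ltW e'0).
have t0t : 0 <= t <= t by rewrite lexx ltW.
have t00 : (0 : R) <= 0 <= t by rewrite lexx ltW.
pose phi s := f (x + t *: v + s *: u) - f (x + s *: u).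
pose dphi s := a (x + t *: v + s *: u) - a (x + s *: u).
have dphiP s : 0 <= s <= t -> is_derive s 1 phi (dphi s).
  move=> st; have [d1 _] := rangeP _ _ st t0t; have [d2 _] := rangeP _ _ st t00.
  rewrite addrAC in d1; rewrite scale0r addr0 in d2.
  by apply: is_deriveB; apply: is_derive_line.
have [||c /itvP cI phiE] := MVT (f := phi) (df := dphi) t0.
- by move=> s /itvP sI; apply: dphiP; rewrite !sI.
- apply: derivable_within_continuous => s /itvP sI.
  by apply: ex_derive; apply: dphiP; rewrite !sI.
have ct : 0 <= c <= t by rewrite !cI.
have [_ le1] := rangeP _ _ ct t0t; have [_ le2] := rangeP _ _ ct t00.
rewrite scale0r !addr0 in le2.
(* The intermediate point [c] is unknown, but its contribution ['d a x (c *: u)] is the same in both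
   expansions and cancels. *)
have dphiE : `|dphi c - t * 'D_v a x| <= e * t.
  have -> : e * t = e / (2 * K) * (t * K) + e / (2 * K) * (t * K).
    by field; rewrite gt_eqF.
  apply: le_trans (lerD le1 le2); apply: le_trans (ler_normB _ _).
  have dE w s : 'd a x (s *: w) = s * 'd a x w by rewrite linearZ.
  rewrite /dphi deriveE// (addrAC x (t *: v)) linearD !dE.
  by rewrite le_eqVlt; apply/orP; left; apply/eqP; congr `|_|; ring.
have -> : f (x + t *: u + t *: v) - f (x + t *: u) - f (x + t *: v) + f x =
    phi t - phi 0.
  rewrite /phi scale0r !addr0 (addrAC x (t *: u)); ring.
rewrite phiE subr0 expr2 -mulrA mulrCA [dphi c * t]mulrC -mulrBr.
rewrite normrM gtr0_norm// mulrCA (ler_pM2l t0).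
exact: dphiE.
Unshelve. all: by end_near. Qed.

Lemma eq_of_quadratic_approx (a b : R) :
  (forall e, 0 < e -> exists d t,
    [/\ 0 < t, `|d - t ^+ 2 * a| <= e * t ^+ 2
      & `|d - t ^+ 2 * b| <= e * t ^+ 2]) ->
  a = b.
Proof.
move=> approx; apply/eqP; rewrite -subr_eq0 -normr_le0.
apply/ler_addgt0Pl => e e0; rewrite addr0.
have [|d [t [t0 le1 le2]]] := approx (e / 2); first by rewrite divr_gt0.
have t20 := exprn_gt0 2 t0.
rewrite -(ler_pM2l t20) -{1}(gtr0_norm t20) -normrM.
have -> : t ^+ 2 * (a - b) = (d - t ^+ 2 * b) - (d - t ^+ 2 * a) by ring.
have -> : t ^+ 2 * e = e / 2 * t ^+ 2 + e / 2 * t ^+ 2 by field.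
exact: le_trans (ler_normB _ _) (lerD le2 le1).
Qed.

(** The second difference is symmetric in [u] and [v], so one and the same number approximates
    [t ^+ 2] times either mixed derivative. *)
Lemma derive_comm f x u v :
  (\forall y \near x, differentiable f y) ->
  differentiable ('D_u f) x -> differentiable ('D_v f) x ->
  'D_v ('D_u f) x = 'D_u ('D_v f) x.
Proof.
move=> df du dv; apply: eq_of_quadratic_approx => e e0.
have [t [t0 [le1 le2]]] := filter_ex (filterI (nbhs_right_gt (0 : R))
  (filterI (second_difference_le v df du e0)
           (second_difference_le u df dv e0))).
exists (f (x + t *: u + t *: v) - f (x + t *: u) - f (x + t *: v) + f x), t.
split; [exact: t0|exact: le1|].
have -> : x + t *: u + t *: v = x + t *: v + t *: u by rewrite addrAC.
rewrite (addrAC (f _)); exact: le2.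
Qed.

End Schwarz.

(** * Matrix-valued functions *)

Section MatrixCalculus.
Context {R : realType}.

Lemma ler_mx_entry_norm m n (A : 'M[R]_(m, n)) i j : `|A i j| <= `|A|.
Proof.
rewrite [leRHS]/Num.Def.normr/= mx_normrE.
exact: (le_bigmax _ (fun ij => `|A ij.1 ij.2|) (i, j)).
Qed.

Lemma ler_norm_mx m n (A : 'M[R]_(m, n)) e : 0 <= e ->
  (forall i j, `|A i j| <= e) -> `|A| <= e.
Proof.
by move=> e0 Ae; rewrite [leLHS]/Num.Def.normr/= mx_normrE bigmax_le.
Qed.

Lemma ler_norm_mulmx m n p (A : 'M[R]_(m, n)) (B : 'M[R]_(n, p)) :
  `|A *m B| <= n%:R * `|A| * `|B|.
Proof.
apply: ler_norm_mx => [|i j]; first by rewrite !mulr_ge0.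
rewrite mxE (le_trans (ler_norm_sum _ _ _))//.
apply: (@le_trans _ _ (\sum_(k < n) `|A| * `|B|)).
  by apply: ler_sum => k _; rewrite normrM ler_pM// ler_mx_entry_norm.
by rewrite sumr_const card_ord -[leLHS]mulr_natl mulrA.
Qed.

Lemma differentiable_mx (V : normedModType R) m n (f : V -> 'M[R]_(m, n)) x :
  (forall i j, differentiable (fun y => f y i j) x) -> differentiable f x.
Proof.
move=> df.
have -> : f = \sum_(i < m) \sum_(j < n) (fun y => f y i j *: delta_mx i j).
  apply/funext => y; rewrite fct_sumE [LHS]matrix_sum_delta.
  by apply: eq_bigr => i _; rewrite fct_sumE.
apply: differentiable_sum => i; apply: differentiable_sum => j.
exact: differentiableZl.
Qed.

(** Finite dimension of the source: [f] is a finite sum of coordinate functions times constant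
    vectors. *)
Lemma mx_linear_continuous (W : normedModType R) m n
  (f : {linear 'M[R]_(m, n) -> W}) : continuous f.
Proof.
move=> x; apply: differentiable_continuous.
have -> : f = (\sum_(i < m) \sum_(j < n)
    (fun y : 'M[R]_(m, n) => y i j *: f (delta_mx i j))) :> (_ -> _).
  apply/funext => y; rewrite fct_sumE {1}[y]matrix_sum_delta linear_sum.
  apply: eq_bigr => i _; rewrite fct_sumE linear_sum.
  by apply: eq_bigr => j _; rewrite linearZ.
apply: differentiable_sum => i; apply: differentiable_sum => j.
exact/differentiableZl/differentiable_coord.
Qed.

Lemma mx_linear_differentiable (W : normedModType R) m n
  (f : {linear 'M[R]_(m, n) -> W}) x : differentiable f x.
Proof. exact/linear_differentiable/mx_linear_continuous. Qed.

Lemma derive_linear (V : normedModType R) (W : normedModType R) m n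
    (f : {linear 'M[R]_(m, n) -> W}) (g : V -> 'M[R]_(m, n)) x v :
  differentiable g x -> 'D_v (f \o g) x = f ('D_v g x).
Proof.
move=> dg; have df := mx_linear_differentiable f (g x).
rewrite !deriveE//; last exact: differentiable_comp.
by rewrite diff_comp//= diff_lin//; exact: mx_linear_continuous.
Qed.

Lemma derive_coord (V : normedModType R) m n (f : V -> 'M[R]_(m, n)) x v i j :
  derivable f x v -> 'D_v (fun y => f y i j) x = 'D_v f x i j.
Proof. by move=> df; rewrite derive_mx// mxE. Qed.

Lemma is_derive_coord (V : normedModType R) m n (f : V -> 'M[R]_(m, n))
    x v i j :
  derivable f x v -> is_derive x v (fun y => f y i j) ('D_v f x i j).
Proof.
move=> df; rewrite -derive_coord//; apply: derivableP.
exact: (derivable_mxP _ _ _).1.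
Qed.

Lemma derive_jac m k (f : 'cV[R]_m -> 'cV[R]_k) x v :
  differentiable f x -> 'D_v f x = jac f x *m v.
Proof.
move=> df; rewrite deriveE// {1}[v]matrix_sum_delta linear_sum.
apply/colP => i; rewrite mxE summxE; apply: eq_bigr => j _.
by rewrite big_ord1 linearZ/= -deriveE// !mxE mulrC.
Qed.

Lemma jac_unique m k (f : 'cV[R]_m -> 'cV[R]_k) x (M : 'M[R]_(k, m)) :
  (forall v, 'D_v f x = M *m v) -> jac f x = M.
Proof. by move=> fM; apply/matrixP => i j; rewrite mxE fM -colE mxE. Qed.

Lemma jac_comp m k l (f : 'cV[R]_m -> 'cV[R]_k) (g : 'cV[R]_k -> 'cV[R]_l) x :
  differentiable f x -> differentiable g (f x) ->
  jac (g \o f) x = jac g (f x) *m jac f x.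
Proof.
move=> df dg; apply: jac_unique => v; rewrite deriveE; last first.
  exact: differentiable_comp.
by rewrite diff_comp//= -!deriveE// !derive_jac// mulmxA.
Qed.

Lemma near_eq_jac m k (f g : 'cV[R]_m -> 'cV[R]_k) x :
  (\forall y \near x, f y = g y) -> jac f x = jac g x.
Proof.
by move=> fg; apply/matrixP => i j; rewrite !mxE (near_eq_derive _ fg).
Qed.

Lemma jac_id m (x : 'cV[R]_m) : jac id x = 1%:M.
Proof. by apply: jac_unique => v; rewrite derive_id mul1mx. Qed.

Lemma dotE m (u v : 'cV[R]_m) : dot u v = \sum_i u i 0 * v i 0.
Proof. by rewrite /dot mxE; apply: eq_bigr => i _; rewrite mxE. Qed.

Lemma derive_grad m (F : 'cV[R]_m -> R) x v :
  differentiable F x -> 'D_v F x = dot (grad F x) v.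
Proof.
move=> dF; rewrite deriveE// {1}[v]matrix_sum_delta linear_sum dotE.
apply: eq_bigr => i _; rewrite big_ord1 linearZ/= -deriveE// mxE.
exact: mulrC.
Qed.

Lemma derive_grad_comp (V : normedModType R) m (F : 'cV[R]_m -> R)
    (g : V -> 'cV[R]_m) x v :
  differentiable g x -> differentiable F (g x) ->
  'D_v (F \o g) x = dot (grad F (g x)) ('D_v g x).
Proof.
move=> dg dF; rewrite deriveE; last exact: differentiable_comp.
by rewrite diff_comp//= -!deriveE// derive_grad.
Qed.

(** The Jacobian of the gradient is the Hessian, so this is [derive_comm] read entry by entry. *)
Lemma jac_grad_sym m (S : 'cV[R]_m -> R) x :
  (\forall y \near x, differentiable S y) -> differentiable (grad S) x ->
  (jac (grad S) x)^T = jac (grad S) x.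
Proof.
move=> dS dg.
have dp i : differentiable (partial i S) x.
  have -> : partial i S = (fun M : 'cV[R]_m => M i 0) \o grad S.
    by apply/funext => y; rewrite /= mxE.
  exact/differentiable_comp/differentiable_coord.
have jE i j : jac (grad S) x i j = 'D_(delta_mx j 0) (partial i S) x.
  have <- : (fun y => grad S y i 0) = partial i S.
    by apply/funext => y; rewrite mxE.
  by rewrite mxE derive_coord//; exact: diff_derivable.
apply/matrixP => i j; rewrite mxE !jE.
exact: (derive_comm dS (dp j) (dp i)).
Qed.

Lemma differentiable_dot (V : normedModType R) m (f g : V -> 'cV[R]_m) x :
  differentiable f x -> differentiable g x ->
  differentiable (fun y => dot (f y) (g y)) x.
Proof.
move=> df dg.
have -> : (fun y => dot (f y) (g y)) = \sum_i (fun y => f y i 0 * g y i 0).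
  by apply/funext => y; rewrite dotE fct_sumE.
apply: differentiable_sum => i; apply: differentiableM.
- exact: (differentiable_comp (g := fun M : 'cV[R]_m => M i 0) df
    (differentiable_coord _ _ _)).
- exact: (differentiable_comp (g := fun M : 'cV[R]_m => M i 0) dg
    (differentiable_coord _ _ _)).
Qed.

Lemma is_derive_dot (V : normedModType R) m (f g : V -> 'cV[R]_m) x v df dg :
  is_derive x v f df -> is_derive x v g dg ->
  is_derive x v (fun y => dot (f y) (g y)) (dot df (g x) + dot (f x) dg).
Proof.
move=> [fx <-] [gx <-].
have -> : (fun y => dot (f y) (g y)) = \sum_i (fun y => f y i 0 * g y i 0).
  by apply/funext => y; rewrite dotE fct_sumE.
rewrite !dotE -big_split/=; apply: is_derive_sum => i.
have fi := is_derive_coord i 0 fx; have gi := is_derive_coord i 0 gx.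
by apply: is_derive_eq; rewrite addrC [g x i 0 *: _]mulrC.
Qed.

End MatrixCalculus.

(** * The inverse function theorem *)

(* The library makes matrices normed modules and complete spaces, but does not
   declare the join that [banach_fixed_point] asks for. *)
HB.instance Definition _ (R : realType) m n := Complete.on 'M[R]_(m, n).

Section InverseFunction.
Context {R : realType}.

(** The mean value theorem is applied to each coordinate of [f - M] on the segment from [y'] to [y].
    The intermediate point may depend on the coordinate, which is harmless for the maximum norm; the
    factor [m%:R] comes from the norm of a matrix product. *)
Lemma ler_norm_increment m k (f : 'cV[R]_m -> 'cV[R]_k) (M : 'M[R]_(k, m))
    x r e :
  (forall y, `|x - y| < r -> differentiable f y /\ `|jac f y - M| <= e) ->
  forall y y', `|x - y| < r -> `|x - y'| < r ->
    `|f y - f y' - M *m (y - y')| <= m%:R * e * `|y - y'|.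
Proof.
move=> rP y y' xy xy'; have e0 : 0 <= e.
  by have [_] := rP _ xy; apply: le_trans.
move uE : (y - y') => u.
(* Balls are convex. The case [c = 0] is separate because strictness is drawn from
   [c * (r - a) > 0]. *)
have seg (c : R) : 0 <= c <= 1 -> `|x - (y' + c *: u)| < r.
  move=> /andP[c0 c1].
  have -> : x - (y' + c *: u) = (1 - c) *: (x - y') + c *: (x - y).
    by rewrite -uE; apply/colP => i; rewrite !mxE; ring.
  rewrite (le_lt_trans (ler_normD _ _))// !normrZ !ger0_norm ?subr_ge0//.
  move: xy xy'; set a := `|x - y|; set b := `|x - y'| => xy xy'.
  have [-> | c0'] := eqVneq c 0; first by rewrite subr0 mul1r mul0r addr0.
  have {}c0 : 0 < c by rewrite lt_def c0' c0.
  have : 0 < c * (r - a) by rewrite mulr_gt0// subr_gt0.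
  have : 0 <= (1 - c) * (r - b) by rewrite mulr_ge0 ?subr_ge0// ltW.
  lra.
apply: ler_norm_mx => [|i j]; first by rewrite !mulr_ge0.
rewrite (ord1 j) {j}.
pose phi (t : R) : R := f (y' + t *: u) i 0 - t * (M *m u) i 0.
pose dphi (t : R) : R := ((jac f (y' + t *: u) - M) *m u) i 0.
have dphiP (t : R) : 0 <= t <= 1 -> is_derive t 1 phi (dphi t).
  move=> t01; have [df _] := rP _ (seg _ t01).
  have dfi : differentiable (fun z => f z i 0) (y' + t *: u).
    exact: (differentiable_comp (g := fun N : 'cV[R]_k => N i 0) df
      (differentiable_coord _ _ _)).
  have -> : dphi t = 'D_u (fun z => f z i 0) (y' + t *: u) - (M *m u) i 0.
    rewrite derive_coord; last exact: diff_derivable.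
    have -> := derive_jac u df; rewrite /dphi.
    by move: (jac f _) => L; rewrite mulmxBl !mxE.
  apply: is_deriveB; first exact: is_derive_line.
  by apply: is_derive_eq; rewrite scaler0 add0r [_ *: 1]mulr1.
have [||c /itvP cI phiE] := MVT (f := phi) (df := dphi) ltr01.
- by move=> t /itvP tI; apply: dphiP; rewrite !tI.
- apply: derivable_within_continuous => t /itvP tI.
  by apply: ex_derive; apply: dphiP; rewrite !tI.
have -> : (f y - f y' - M *m u) i 0 = phi 1 - phi 0.
  by rewrite /phi scale1r scale0r addr0 -uE subrKC !mxE; ring.
have c01 : 0 <= c <= 1 by rewrite !cI.
have [_ le1] := rP _ (seg _ c01).
rewrite phiE subr0 mulr1 (le_trans (ler_mx_entry_norm _ _ _))//.
rewrite (le_trans (ler_norm_mulmx _ _))// ler_wpM2r//.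
by rewrite ler_wpM2l.
Qed.

Lemma C1_on_near_jac m k (U : set 'cV[R]_m) (f : 'cV[R]_m -> 'cV[R]_k) x :
  open U -> U x -> C1_on U f -> forall e, 0 < e ->
  exists2 r, 0 < r & forall y, `|x - y| < r -> U y /\ `|jac f y - jac f x| <= e.
Proof.
move=> Uo Ux fC e e0.
have jx : \forall y \near x, `|jac f x - jac f y| <= e.
  by have [_ /cvgrPdist_le] := fC _ Ux; apply.
have [r /= r0 rP] :=
  (nbhs_normP _ _).1 (filterI (open_nbhs_nbhs (conj Uo Ux)) jx).
exists r; first by [].
move=> y xy; have [Uy le1] := rP y xy; split; first exact: Uy.
by rewrite distrC; exact: le1.
Qed.

Lemma unitmx_inj m (L : 'M[R]_m) :
  (forall v : 'cV[R]_m, L *m v = 0 -> v = 0) -> L \in unitmx.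
Proof.
move=> Linj; rewrite -unitmx_tr -row_free_unit -kermx_eq0.
apply/eqP/row_matrixP => i; rewrite row0; apply: trmx_inj; rewrite trmx0.
apply: Linj; apply: trmx_inj; rewrite trmx_mul trmxK trmx0.
by rewrite -row_mul mulmx_ker row0.
Qed.

Lemma mulmx_bound m n (N : 'M[R]_(m, n)) :
  exists2 c, 0 < c & forall v : 'cV[R]_n, `|N *m v| <= c * `|v|.
Proof.
(* Adding 1 keeps the constant positive even when [N = 0]. *)
exists (n%:R * `|N| + 1) => [|v]; first by rewrite ltr_wpDl// mulr_ge0.
by rewrite (le_trans (ler_norm_mulmx _ _))// ler_wpM2r// lerDl.
Qed.

(** * Local inversion of maps close to an invertible linear map *)

Section NearlyLinear.
Variables (m : nat) (M : 'M[R]_m) (f : 'cV[R]_m -> 'cV[R]_m) (x : 'cV[R]_m).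
Variables (c r e : R).
Hypotheses (Mu : M \in unitmx) (c0 : 0 < c) (r0 : 0 < r) (ce : c * e <= 2^-1).
Hypothesis cP : forall v : 'cV[R]_m, `|invmx M *m v| <= c * `|v|.
Hypothesis fP : forall y y', `|x - y| < r -> `|x - y'| < r ->
  `|f y - f y' - M *m (y - y')| <= e * `|y - y'|.

(** Simplified Newton iteration with frozen slope [M]: the solutions of [f y = w] are the fixed
    points of [y |-> h y + invmx M *m w]. *)
Let h y := y - invmx M *m f y.

(** The linear part cancels: only [invmx M] applied to the deviation of [f] from [M] remains, with
    Lipschitz constant [c * e], at most one half. *)
Let h_lip y y' : `|x - y| < r -> `|x - y'| < r ->
  `|h y - h y'| <= 2^-1 * `|y - y'|.
Proof.
move=> xy xy'.
have -> : h y - h y' = - (invmx M *m (f y - f y' - M *m (y - y'))).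
  rewrite /h mulmxBr mulKmx// mulmxBr.
  by apply/colP => i; rewrite !mxE; ring.
rewrite normrN (le_trans (cP _))//.
rewrite (@le_trans _ _ (c * (e * `|y - y'|)))//.
  by rewrite ler_wpM2l ?(ltW c0)// fP.
by rewrite mulrA ler_wpM2r.
Qed.

(** Write [y - y'] as [invmx M *m (f y - f y')] plus [h y - h y']; the second term is at most half
    of the left side and is absorbed, which doubles [c]. *)
Lemma nearly_linear_inj y y' : `|x - y| < r -> `|x - y'| < r ->
  `|y - y'| <= 2 * c * `|f y - f y'|.
Proof.
move=> xy xy'; have := h_lip xy xy'; have := cP (f y - f y').
have -> : invmx M *m (f y - f y') = (y - y') - (h y - h y').
  by rewrite /h mulmxBr; apply/colP => i; rewrite !mxE; ring.
have := ler_normD (y - y' - (h y - h y')) (h y - h y').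
rewrite subrK; lra.
Qed.

(** Banach's fixed point theorem on the closed ball of radius [d]. The ball is mapped into itself
    because the shift of the centre and the contraction contribute at most [d / 2] each. *)
Lemma nearly_linear_surj d w : 0 < d < r -> 2 * c * `|f x - w| <= d ->
  exists2 y, `|x - y| <= d & f y = w.
Proof.
move=> /andP[d0 dr] wd; pose B := closed_ball_ Num.norm x d.
have Br y : B y -> `|x - y| < r by move=> yB; apply: le_lt_trans dr.
pose T y := h y + invmx M *m w.
have TB : set_fun B B T.
  move=> y yB; rewrite /B /closed_ball_ /=.
  have -> : x - T y = (h x - h y) + invmx M *m (f x - w).
    by rewrite /T /h mulmxBr; apply/colP => i; rewrite !mxE; ring.
  rewrite (le_trans (ler_normD _ _))//.
  have xr : `|x - x| < r by rewrite subrr normr0.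
  have := h_lip xr (Br _ yB); have := cP (f x - w).
  have : `|x - y| <= d by [].
  lra.
have [|||y yB yE] := @banach_fixed_point R _ B (mkfun TB).
- exists (2^-1)%:nng; split=> /=; first by rewrite invf_lt1// ltr1n.
  move=> -[y y'] /= [yB y'B].
  by rewrite /T opprD addrACA subrr addr0 h_lip//; exact: Br.
- exact: closed_closed_ball_.
- by exists x; rewrite /B /closed_ball_ /= subrr normr0 ltW.
have {}yE : y = y - invmx M *m f y + invmx M *m w by exact: yE.
exists y; first exact: yB.
have : invmx M *m (f y - w) = 0.
  have -> : invmx M *m (f y - w) = y - (y - invmx M *m f y + invmx M *m w).
    by rewrite mulmxBr; apply/colP => i; rewrite !mxE; ring.
  by rewrite -yE subrr.
move/(congr1 (mulmx M)); rewrite mulKVmx// mulmx0 => /eqP.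
by rewrite subr_eq0 => /eqP.
Qed.

Lemma nearly_linear_inverse d : 0 < d < r ->
  exists g : 'cV[R]_m -> 'cV[R]_m,
    [/\ forall y, `|x - y| <= d -> g (f y) = y,
        forall w, 2 * c * `|f x - w| <= d -> `|x - g w| <= d /\ f (g w) = w
      & forall v w, 2 * c * `|f x - v| <= d -> 2 * c * `|f x - w| <= d ->
        `|g v - g w| <= 2 * c * `|v - w|].
Proof.
move=> d0r; have /andP[_ dr] := d0r.
pose A w := [set y | `|x - y| <= d /\ f y = w].
(* The default value [x] is taken only where [w] has no preimage in the closed ball, which none of
   the three claims concerns. *)
pose g w := xget x (A w).
have gP w : A w !=set0 -> `|x - g w| <= d /\ f (g w) = w.
  by move=> [y yA]; apply: (@xgetPex _ x (A w)); exists y.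
have gw w : 2 * c * `|f x - w| <= d -> `|x - g w| <= d /\ f (g w) = w.
  by move=> /(nearly_linear_surj d0r)[y yd fy]; apply: gP; exists y.
exists g; split.
- move=> y yd; have [gd fg] : `|x - g (f y)| <= d /\ f (g (f y)) = f y.
    by apply: gP; exists y.
  apply/eqP; rewrite -subr_eq0 -normr_le0.
  have := nearly_linear_inj (le_lt_trans gd dr) (le_lt_trans yd dr).
  by rewrite fg subrr normr0 mulr0.
- exact: gw.
- move=> v w /gw[vd fv] /gw[wd fw]; rewrite -{2}fv -{2}fw.
  by apply: nearly_linear_inj; exact: le_lt_trans dr.
Qed.

End NearlyLinear.

(** The candidate differential is the inverse of [jac f (g w)]. The Lipschitz bound on [g] converts
    an error small relative to [g v - g w] into one small relative to [v - w]. *)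
Lemma inverse_differentiable m (f g : 'cV[R]_m -> 'cV[R]_m) w k :
  0 < k -> differentiable f (g w) -> jac f (g w) \in unitmx ->
  (\forall v \near w, f (g v) = v /\ `|g v - g w| <= k * `|v - w|) ->
  differentiable g w.
Proof.
move=> k0 df Lu gP; have fw := (nbhs_singleton gP).1.
have [l l0 lP] := mulmx_bound (invmx (jac f (g w))).
apply: (proj1 (differentiable_of_near_le
  (df := mulmx (invmx (jac f (g w)))) _ _)); first exact: mx_linear_continuous.
(* The error of [f] is later multiplied by [l], the bound on the inverse matrix, and by [k], the
   Lipschitz constant of [g]. *)
move=> e e0; have e'0 : 0 < e / (l * k) by rewrite divr_gt0 ?mulr_gt0.
have [s /= s0 sP] := (nbhs_normP _ _).1 (differentiable_near_le df e'0).
have Nw : \forall v \near w, k * `|v - w| < s.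
  apply/nbhs_ballP; exists (k^-1 * s) => /=.
    by rewrite mulr_gt0// invr_gt0.
  by move=> v; rewrite -ball_normE /= distrC ltr_pdivlMl.
apply: filterS2 gP Nw => v [fv gvw] vw.
have := sP (g v); rewrite /= distrC => /(_ (le_lt_trans gvw vw)).
rewrite -deriveE// derive_jac// fv fw => le1.
have -> : g v - g w - invmx (jac f (g w)) *m (v - w) =
    - (invmx (jac f (g w)) *m (v - w - jac f (g w) *m (g v - g w))).
  by rewrite [in RHS]mulmxBr mulKmx// opprB.
rewrite normrN (le_trans (lP _))//.
rewrite (@le_trans _ _ (l * (e / (l * k) * (k * `|v - w|))))//.
  by rewrite ler_wpM2l ?(ltW l0)// (le_trans le1)// ler_wpM2l// ltW.
rewrite le_eqVlt; apply/orP; left; apply/eqP; field.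
by rewrite !gt_eqF.
Qed.

(** A kernel vector [v] of [L] satisfies [v = - invmx M *m ((L - M) *m v)], hence has at most half
    its own norm and vanishes. *)
Lemma unitmx_perturb m (M L : 'M[R]_m) c e : M \in unitmx -> 0 < c ->
  (forall v : 'cV[R]_m, `|invmx M *m v| <= c * `|v|) ->
  `|L - M| <= e -> c * (m%:R * e) <= 2^-1 -> L \in unitmx.
Proof.
move=> Mu c0 cP Le ce; apply: unitmx_inj => v Lv0.
have vE : v = - (invmx M *m ((L - M) *m v)).
  by rewrite mulmxBl Lv0 sub0r mulmxN opprK mulKmx.
apply/eqP; rewrite -normr_le0.
suff : `|v| <= 2^-1 * `|v| by lra.
rewrite {1}vE normrN (le_trans (cP _))//.
rewrite (@le_trans _ _ (c * (m%:R * e * `|v|)))//.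
  rewrite ler_wpM2l ?(ltW c0)// (le_trans (ler_norm_mulmx _ _))//.
  by rewrite ler_wpM2r// ler_wpM2l.
by rewrite mulrA ler_wpM2r.
Qed.

Theorem inverse_function m (U : set 'cV[R]_m) (f : 'cV[R]_m -> 'cV[R]_m) x :
  open U -> U x -> C1_on U f -> jac f x \in unitmx ->
  exists g : 'cV[R]_m -> 'cV[R]_m,
    (\forall y \near x, g (f y) = y) /\
    (\forall w \near f x, [/\ U (g w), f (g w) = w & differentiable g w]).
Proof.
move=> Uo Ux fC Mu; have [c c0 cP] := mulmx_bound (invmx (jac f x)).
(* Chosen so that [c * (m%:R * e)] stays below one half, the contraction constant; [m%:R + 1]
   instead of [m%:R] covers [m = 0]. *)
pose e := (2 * c * (m%:R + 1))^-1.
have m0 : 0 < m%:R + 1 :> R by rewrite ltr_wpDl.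
have e0 : 0 < e by rewrite invr_gt0 !mulr_gt0.
have ce : c * (m%:R * e) <= 2^-1.
  have -> : c * (m%:R * e) = 2^-1 - c * e by rewrite /e; field; rewrite !gt_eqF.
  by rewrite gerBl mulr_ge0 ?ltW.
have [r r0 rU] := C1_on_near_jac Uo Ux fC e0.
have rM y : `|x - y| < r -> differentiable f y /\ `|jac f y - jac f x| <= e.
  move=> xy; have [Uy le1] := rU y xy; split; last exact: le1.
  by have [] := fC _ Uy.
have d0r : 0 < r / 2 < r by rewrite divr_gt0//=; lra.
have /andP[d0 dr] := d0r.
have [g [gf fg gl]] :=
  nearly_linear_inverse Mu c0 r0 ce cP (ler_norm_increment rM) d0r.
exists g; split.
  apply/nbhs_ballP; exists (r / 2) => //= y; rewrite -ball_normE => /ltW.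
  exact: gf.
have c20 : 0 < 2 * c by rewrite mulr_gt0.
have near_fx : \forall w \near f x, 2 * c * `|f x - w| <= r / 2.
  apply/nbhs_ballP; exists ((2 * c)^-1 * (r / 2)) => /=.
    by rewrite mulr_gt0// invr_gt0.
  by move=> v; rewrite -ball_normE /= ltr_pdivlMl// => /ltW.
(* Differentiability of [g] at [w] needs the estimates on a whole neighbourhood of [w], hence the
   passage to the interior. *)
apply: filterS (nbhs_interior near_fx) => w wI; have wx := nbhs_singleton wI.
have [gd fgw] := fg _ wx; have gr := le_lt_trans gd dr.
split; [by have [] := rU _ gr|exact: fgw|].
have [df le1] := rM _ gr.
apply: (inverse_differentiable c20 df).
  exact: unitmx_perturb Mu c0 cP le1 ce.
apply: filterS wI => v vx; split; first by have [] := fg _ vx.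
exact: gl.
Qed.

End InverseFunction.

(** * Generating function of a regularized step *)

Section DotAndExtrema.
Context {R : realType}.

Lemma dotC m (u v : 'cV[R]_m) : dot u v = dot v u.
Proof. by rewrite !dotE; apply: eq_bigr => i _; rewrite mulrC. Qed.

Lemma dotDl m (u v w : 'cV[R]_m) : dot (u + v) w = dot u w + dot v w.
Proof. by rewrite /dot linearD mulmxDl mxE. Qed.

Lemma dotNl m (u v : 'cV[R]_m) : dot (- u) v = - dot u v.
Proof. by rewrite /dot linearN mulNmx mxE. Qed.

Lemma dotZl m k (u v : 'cV[R]_m) : dot (k *: u) v = k * dot u v.
Proof. by rewrite /dot linearZ -scalemxAl mxE. Qed.

Lemma dotDr m (u v w : 'cV[R]_m) : dot w (u + v) = dot w u + dot w v.
Proof. by rewrite dotC dotDl !(dotC w). Qed.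

Lemma dotNr m (u v : 'cV[R]_m) : dot v (- u) = - dot v u.
Proof. by rewrite dotC dotNl dotC. Qed.

Lemma dotZr m k (u v : 'cV[R]_m) : dot v (k *: u) = k * dot v u.
Proof. by rewrite dotC dotZl dotC. Qed.

Lemma dot_col_mx m n (u1 v1 : 'cV[R]_m) (u2 v2 : 'cV[R]_n) :
  dot (col_mx u1 u2) (col_mx v1 v2) = dot u1 v1 + dot u2 v2.
Proof. by rewrite /dot tr_col_mx mul_row_col mxE. Qed.

Lemma mulmx_Jmx m (v : 'cV[R]_(m + m)) :
  Jmx m *m v = col_mx (dsubmx v) (- usubmx v).
Proof.
rewrite -{1}[v]vsubmxK mul_block_col !mul0mx mulNmx !mul1mx.
by rewrite add0r addr0.
Qed.

Lemma differentiable_mulmx (V : normedModType R) m n p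
    (f : V -> 'M[R]_(m, n)) (g : V -> 'M[R]_(n, p)) x :
  differentiable f x -> differentiable g x ->
  differentiable (fun y => f y *m g y) x.
Proof.
move=> df dg; apply: differentiable_mx => i j.
have -> : (fun y => (f y *m g y) i j) = \sum_k (fun y => f y i k * g y k j).
  by apply/funext => y; rewrite mxE fct_sumE.
apply: differentiable_sum => k; apply: differentiableM.
- exact: (differentiable_comp (g := fun M : 'M[R]_(m, n) => M i k) df
    (differentiable_coord _ _ _)).
- exact: (differentiable_comp (g := fun M : 'M[R]_(n, p) => M k j) dg
    (differentiable_coord _ _ _)).
Qed.

Section ColMx.
Variables (V : normedModType R) (m n : nat).
Variables (f : V -> 'cV[R]_m) (g : V -> 'cV[R]_n) (x : V).
Hypotheses (df : differentiable f x) (dg : differentiable g x).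

Lemma differentiable_col_mx : differentiable (fun y => col_mx (f y) (g y)) x.
Proof.
apply: differentiable_mx => i j; case: (split_ordP i) => k ->.
- under eq_fun do rewrite col_mxEu.
  exact: (differentiable_comp (g := fun M : 'cV[R]_m => M k j) df
    (differentiable_coord _ _ _)).
- under eq_fun do rewrite col_mxEd.
  exact: (differentiable_comp (g := fun M : 'cV[R]_n => M k j) dg
    (differentiable_coord _ _ _)).
Qed.

Lemma derive_col_mx v :
  'D_v (fun y => col_mx (f y) (g y)) x = col_mx ('D_v f x) ('D_v g x).
Proof.
have dF := differentiable_col_mx.
have uE : usubmx \o (fun y => col_mx (f y) (g y)) = f.
  by apply/funext => y; exact: col_mxKu.
have dE : dsubmx \o (fun y => col_mx (f y) (g y)) = g.
  by apply/funext => y; exact: col_mxKd.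
have := derive_linear usubmx v dF; have := derive_linear dsubmx v dF.
by rewrite uE dE => -> ->; rewrite vsubmxK.
Qed.

End ColMx.

(** Fermat's rule for the restriction of [f] to the line through [x] in direction [v]. *)
Lemma derive_local_min (V : normedModType R) (f : V -> R) x v :
  (\forall y \near x, differentiable f y) -> (\forall y \near x, f x <= f y) ->
  'D_v f x = 0.
Proof.
move=> df fx; have [r /= r0 rP] := (nbhs_normP _ _).1 (filterI df fx).
(* For [t] below [d] in absolute value, [t *: v] stays within radius [r]; the 1 covers [v = 0]. *)
pose d := r / (`|v| + 1).
have v0 : 0 < `|v| + 1 by rewrite ltr_wpDl.
have d0 : 0 < d by rewrite divr_gt0.
have close (t : R) : t \in `]- d, d[ ->
    differentiable f (x + t *: v) /\ f x <= f (x + t *: v).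
  rewrite in_itv/= -ltr_norml ltr_pdivlMr// => td; apply: rP.
  rewrite /ball_/= opprD addNKr normrN normrZ (le_lt_trans _ td)//.
  by rewrite ler_wpM2l// lerDl.
have d00 : 0 \in `]- d, d[ by rewrite in_itv/= oppr_lt0 d0.
have := derive1_at_min (f := fun t : R => f (x + t *: v))
  (a := - d) (b := d) (c := 0).
case=> //.
- by rewrite (@le_trans _ _ 0) ?oppr_le0 ?ltW.
- by move=> t /close[dft _]; apply: ex_derive; exact: is_derive_line.
- by move=> t /close[_]; rewrite scale0r addr0.
move=> _ <-; have [+ _] := close _ d00 => /is_derive_line.
by move=> /@derive_val ->; rewrite scale0r addr0.
Qed.

Lemma derive_local_max (V : normedModType R) (f : V -> R) x v :
  (\forall y \near x, differentiable f y) -> (\forall y \near x, f y <= f x) ->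
  'D_v f x = 0.
Proof.
move=> df fx; have dfx := nbhs_singleton df.
apply: oppr_inj; rewrite oppr0 -deriveN; last exact: diff_derivable.
apply: derive_local_min.
  by apply: filterS df => y; exact: differentiableN.
by apply: filterS fx => y; rewrite lerN2.
Qed.

(** Since [psi] contains second derivatives of [F], differentiating it takes third ones; this
    accounts for the class C^3. *)
Lemma differentiable_psi m (F : 'cV[R]_(m + m) -> R) z :
  of_class_C 3 F -> differentiable (psi F) z.
Proof.
move=> [_ C2].
have dg : differentiable (grad F) z.
  apply: differentiable_mx => i j; under eq_fun do rewrite mxE.
  by have [+ _] := C2 i; apply.
have dX : differentiable (fun y => Jmx m *m grad F y) z.
  by apply: differentiable_mulmx => //; exact: differentiable_cst.
have dh : differentiable (hess F) z.
  apply: differentiable_mx => i j; under eq_fun do rewrite mxE.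
  by have [_ /(_ j)[+ _]] := C2 i; apply.
have -> : psi F = (fun y => dot (Jmx m *m grad F y)
    (hess F y *m (Jmx m *m grad F y))).
  by apply/funext => y; rewrite /psi /dot [in RHS]mulmxA.
apply: differentiable_dot => //; exact: differentiable_mulmx.
Qed.

End DotAndExtrema.

Lemma dot_delta_mx (R : realType) m (u : 'cV[R]_m) i :
  dot u (delta_mx i 0) = u i 0.
Proof. by rewrite /dot -colE !mxE. Qed.

(** Here [col_mx p q] stands for the Hessian of a generating function. With blocks P1, P2 over Q1,
    Q2, symmetry makes P1 and Q2 symmetric and Q1 the transpose of P2, and both sides become the
    block matrix with rows (0, P2) and (-P2^T, 0). *)
Lemma sym_block_preserve_Jmx (R : realType) m (p q : 'M[R]_(m, m + m)) :
  (col_mx p q)^T = col_mx p q ->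
  let A := col_mx (row_mx 1%:M 0) p in let B := col_mx q (row_mx 0 1%:M) in
  A^T *m Jmx m *m A = B^T *m Jmx m *m B.
Proof.
rewrite -[p]hsubmxK -[q]hsubmxK.
move: (lsubmx p) (rsubmx p) (lsubmx q) (rsubmx q) => P1 P2 Q1 Q2.
rewrite -!block_mxEv !tr_block_mx => /eq_block_mx[P1E Q1E P2E Q2E] A B.
rewrite {}/A {}/B !tr_block_mx !mulmx_block.
rewrite !(trmx0, trmx1, mulmx0, mul0mx, mulmxN, mulNmx, mulmx1, mul1mx).
rewrite !(addr0, add0r) P1E Q1E P2E Q2E.
by rewrite !mulNmx !mul1mx !mul0mx !addNr addr0 add0r.
Qed.

(** * The vertices and their midpoint as functions of x *)

Section Vertices.
Context {R : realType} {m : nat}.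
Variables (U : set 'cV[R]_(m + m)) (Q P : 'cV[R]_(m + m) -> 'cV[R]_m).
Hypotheses (Uo : open U) (QC : C1_on U Q) (PC : C1_on U P).

Lemma differentiable_start_vertex x : U x -> differentiable (start_vertex P) x.
Proof.
move=> /PC[dP _]; apply: differentiable_col_mx => //.
exact: (mx_linear_differentiable usubmx).
Qed.

Lemma differentiable_end_vertex x : U x -> differentiable (end_vertex Q) x.
Proof.
move=> /QC[dQ _]; apply: differentiable_col_mx => //.
exact: (mx_linear_differentiable dsubmx).
Qed.

Lemma derive_submx x v :
  ('D_v usubmx x = usubmx v :> 'cV[R]_m) *
  ('D_v dsubmx x = dsubmx v :> 'cV[R]_m).
Proof.
split; (rewrite deriveE; last exact: mx_linear_differentiable);
  by rewrite diff_lin//; exact: mx_linear_continuous.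
Qed.

Lemma derive_start_vertex x v : U x ->
  'D_v (start_vertex P) x = col_mx (usubmx v) ('D_v P x).
Proof.
move=> /PC[dP _]; rewrite derive_col_mx ?derive_submx//.
exact: (mx_linear_differentiable usubmx).
Qed.

Lemma derive_end_vertex x v : U x ->
  'D_v (end_vertex Q) x = col_mx ('D_v Q x) (dsubmx v).
Proof.
move=> /QC[dQ _]; rewrite derive_col_mx ?derive_submx//.
exact: (mx_linear_differentiable dsubmx).
Qed.

Lemma jac_start_vertex x : U x ->
  jac (start_vertex P) x = col_mx (row_mx 1%:M 0) (jac P x).
Proof.
move=> Ux; apply: jac_unique => v; rewrite derive_start_vertex// mul_col_mx.
have [dP _] := PC Ux; rewrite derive_jac//; congr col_mx.
by rewrite -{2}[v]vsubmxK mul_row_col mul1mx mul0mx addr0.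
Qed.

Lemma jac_end_vertex x : U x ->
  jac (end_vertex Q) x = col_mx (jac Q x) (row_mx 0 1%:M).
Proof.
move=> Ux; apply: jac_unique => v; rewrite derive_end_vertex// mul_col_mx.
have [dQ _] := QC Ux; rewrite derive_jac//; congr col_mx.
by rewrite -{2}[v]vsubmxK mul_row_col mul1mx mul0mx add0r.
Qed.

Lemma C1_on_start_vertex : C1_on U (start_vertex P).
Proof.
move=> x Ux; split; first exact: differentiable_start_vertex.
have [_ /cvgrPdist_le cP] := PC Ux.
have nU : \forall y \near x, U y by exact: open_nbhs_nbhs.
apply/(@cvgrPdist_le _ _ _ (nbhs x)) => e e0.
have nP : \forall y \near x, `|jac P x - jac P y| <= e := cP _ e0.
near=> y; have Uy : U y by near: y.
have le1 : `|jac P x - jac P y| <= e by near: y.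
rewrite !jac_start_vertex// opp_col_mx add_col_mx subrr.
apply: ler_norm_mx => [|i j]; first exact: ltW.
case: (split_ordP i) => k ->; first by rewrite col_mxEu mxE normr0 ltW.
rewrite col_mxEd; exact: le_trans (ler_mx_entry_norm _ _ _) le1.
Unshelve. all: by end_near. Qed.

Lemma action_vertices x : action (start_vertex P x) (end_vertex Q x) =
  2^-1 * dot (Q x - usubmx x) (dsubmx x - P x).
Proof.
rewrite /action /start_vertex /end_vertex opp_col_mx add_col_mx.
by rewrite col_mxKu col_mxKd.
Qed.

Let mid y := midpoint (start_vertex P y) (end_vertex Q y).

Lemma differentiable_midpoint x : U x -> differentiable mid x.
Proof.
move=> Ux; apply: differentiableZ; apply: differentiableD.
  exact: differentiable_end_vertex.
exact: differentiable_start_vertex.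
Qed.

Lemma derive_midpoint x v : U x -> 'D_v mid x =
  2^-1 *: col_mx ('D_v Q x + usubmx v) (dsubmx v + 'D_v P x).
Proof.
move=> Ux; have ds := differentiable_start_vertex Ux.
have de := differentiable_end_vertex Ux.
rewrite deriveZ; last by apply/derivableD; exact: diff_derivable.
rewrite deriveD; try exact: diff_derivable.
by rewrite derive_start_vertex// derive_end_vertex// add_col_mx.
Qed.

End Vertices.

(** * Generating function and symplecticity for one step *)

Section Step.
Context {R : realType} {m : nat}.
Variables (F : 'cV[R]_(m + m) -> R) (b : bool) (c : R).
Variables (U : set 'cV[R]_(m + m)) (Q P : 'cV[R]_(m + m) -> 'cV[R]_m).
Variables (Lam Mu : 'cV[R]_(m + m) -> R).
Hypotheses (F_smooth : of_class_C 3 F).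
Hypotheses (Uo : open U) (QC : C1_on U Q) (PC : C1_on U P).
Hypothesis eqs : forall x, U x -> regularized_DTH_eqs b F c
  (start_vertex P x) (end_vertex Q x) (Lam x) (Mu x).

Let mid y := midpoint (start_vertex P y) (end_vertex Q y).

Let dF z : differentiable F z. Proof. by have [+ _] := F_smooth; apply. Qed.

Let near_U x : U x -> \forall y \near x, U y.
Proof. by move=> Ux; apply: open_nbhs_nbhs. Qed.

Lemma constraint_stationary x v : U x -> 'D_v (F \o mid) x = 0.
Proof.
move=> Ux; rewrite -(derive_cst (0 : R) x v); apply: near_eq_derive.
by apply: filterS (near_U Ux) => y /eqs[_ [F0 _] _ _].
Qed.

(** By complementarity either [Mu x = 0] or [psi F (mid x) = c]. In the second case the inequality
    at neighbouring points makes [x] a local minimum or maximum of [psi F \o mid], according to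
    [b]. *)
Lemma active_constraint_stationary x v : U x ->
  Mu x * 'D_v (psi F \o mid) x = 0.
Proof.
move=> Ux; have [_ _ Mu0 _] := eqs Ux.
have [->|Mux] := eqVneq (Mu x) 0; first by rewrite mul0r.
have psic : psi F (mid x) = c.
  by move/eqP: Mu0; rewrite mulf_eq0 (negPf Mux) subr_eq0 => /eqP.
have dpsi : \forall y \near x, differentiable (psi F \o mid) y.
  apply: filterS (near_U Ux) => y Uy; apply: differentiable_comp.
    exact: (differentiable_midpoint QC PC).
  exact: differentiable_psi.
have ext : \forall y \near x, psi_constraint b F c (mid y).
  by apply: filterS (near_U Ux) => y /eqs[_ [_ ?] _ _].
suff -> : 'D_v (psi F \o mid) x = 0 by rewrite mulr0.
case: (b) ext => ext; [apply: derive_local_min|apply: derive_local_max] => //;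
  by apply: filterS ext => y; rewrite /psi_constraint /= psic.
Qed.

(** The step equation says that [Lam x *: g + Mu x *: k] is (-dp, dq), where (dq, dp) is the jump
    from start to end vertex and [g], [k] are the gradients of [F] and [psi F] at the midpoint.
    Pairing it with the derivative of the midpoint gives zero by the two stationarity lemmas. *)
Lemma multiplier_work x v : U x ->
  dot (dsubmx x - P x) ('D_v Q x + usubmx v) =
  dot (Q x - usubmx x) (dsubmx v + 'D_v P x).
Proof.
move=> Ux; have [+ _ _ _] := eqs Ux.
have := active_constraint_stationary v Ux; have := constraint_stationary v Ux.
have dm := differentiable_midpoint QC PC Ux.
rewrite !derive_grad_comp//; last exact: differentiable_psi.
rewrite (derive_midpoint QC PC)//; rewrite -/(mid x).
set g := grad F _; set k := grad _ _; set w := col_mx _ _.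
move=> Fw kw.
rewrite !mulmx_Jmx /start_vertex /end_vertex opp_col_mx add_col_mx.
rewrite !scale_col_mx add_col_mx => /eq_col_mx[qE pE].
have : Lam x * dot g (2^-1 *: w) + Mu x * dot k (2^-1 *: w) = 0.
  by rewrite Fw kw mulr0 addr0.
rewrite !dotZr -{1}[g]vsubmxK -{1}[k]vsubmxK !dot_col_mx qE pE.
rewrite !(dotDl, dotZl, dotNl) => H.
apply/eqP; rewrite -subr_eq0; apply/eqP.
(* The factor -2 undoes the half in the midpoint and matches the sign from [Jmx]. *)
by rewrite -[RHS](mulr0 (- 2)) -H; field.
Qed.

(** [Lam] and [Mu] come with no regularity, so the generating function is differentiated through
    this expression in [Q] and [P] alone. *)
Let S0 x := dot (usubmx x) (dsubmx x) +
  2^-1 * dot (Q x - usubmx x) (dsubmx x - P x).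

Lemma DTH_genfunE x : U x -> DTH_genfun F c Q P Lam Mu x = S0 x.
Proof.
move=> /eqs[_ [F0 _] Mu0 _].
by rewrite /DTH_genfun /lagrangian F0 Mu0 mulr0 !addr0 action_vertices.
Qed.

Let S0_differentiable x : U x -> differentiable S0 x.
Proof.
move=> Ux; have [dQ _] := QC Ux; have [dP _] := PC Ux.
have du := mx_linear_differentiable (usubmx : 'cV[R]_(m + m) -> 'cV[R]_m) x.
have dd := mx_linear_differentiable (dsubmx : 'cV[R]_(m + m) -> 'cV[R]_m) x.
apply: differentiableD; first exact: differentiable_dot.
apply: differentiableZ; apply: differentiable_dot; exact: differentiableB.
Qed.

(** The product rule leaves derivatives of [Q] and [P] in the action; [multiplier_work] trades them
    for terms in [usubmx v] and [dsubmx v], which turn the coefficients p_b and q_a into [P x] and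
    [Q x]. *)
Let S0_derive x v : U x ->
  'D_v S0 x = dot (col_mx (P x) (Q x)) v.
Proof.
move=> Ux; have [dQ _] := QC Ux; have [dP _] := PC Ux.
have iu : is_derive x v (usubmx : 'cV[R]_(m + m) -> 'cV[R]_m) (usubmx v).
  rewrite -(derive_submx x v).1; apply/derivableP/diff_derivable.
  exact: mx_linear_differentiable.
have id : is_derive x v (dsubmx : 'cV[R]_(m + m) -> 'cV[R]_m) (dsubmx v).
  rewrite -(derive_submx x v).2; apply/derivableP/diff_derivable.
  exact: mx_linear_differentiable.
have iQ := derivableP (diff_derivable (v := v) dQ).
have iP := derivableP (diff_derivable (v := v) dP).
have dS : 'D_v S0 x = (dot (usubmx v) (dsubmx x) + dot (usubmx x) (dsubmx v)) +
    2^-1 * (dot ('D_v Q x - usubmx v) (dsubmx x - P x) +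
            dot (Q x - usubmx x) (dsubmx v - 'D_v P x)).
  by case: (is_deriveD (is_derive_dot iu id) (is_deriveZ (2^-1)
    (is_derive_dot (is_deriveB iQ iu) (is_deriveB id iP)))).
rewrite dS -[v in RHS]vsubmxK dot_col_mx (dotC (P x)).
have := multiplier_work v Ux; rewrite dotC.
rewrite !(dotDl, dotDr, dotNl, dotNr) => mw.
lra.
Qed.

Lemma DTH_genfun_generating :
  generating_function U (DTH_genfun F c Q P Lam Mu) Q P.
Proof.
move=> x Ux.
have nE : \forall y \near x, DTH_genfun F c Q P Lam Mu y = S0 y.
  by apply: filterS (near_U Ux) => y; exact: DTH_genfunE.
have gE : grad (DTH_genfun F c Q P Lam Mu) x = col_mx (P x) (Q x).
  apply/colP => i; rewrite mxE /partial (near_eq_derive _ nE) S0_derive//.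
  exact: dot_delta_mx.
rewrite gE col_mxKu col_mxKd; split=> //.
apply: near_eq_differentiable (S0_differentiable Ux).
by apply: filterS nE => y.
Qed.

(** Near [x] the gradient of the generating function is [col_mx (P y) (Q y)], so this matrix is its
    Hessian; differentiability of [P] and [Q] is what the symmetry of second derivatives asks
    for. *)
Lemma jac_vertices_sym x : U x ->
  let W := col_mx (jac P x) (jac Q x) in W^T = W.
Proof.
move=> Ux W; have [dQ _] := QC Ux; have [dP _] := PC Ux.
pose S := DTH_genfun F c Q P Lam Mu.
have nE : \forall y \near x, grad S y = col_mx (P y) (Q y).
  apply: filterS (near_U Ux) => y /DTH_genfun_generating[_ <- <-].
  by rewrite vsubmxK.
have WE : jac (grad S) x = W.
  rewrite (near_eq_jac nE); apply: jac_unique => v.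
  by rewrite derive_col_mx// mul_col_mx !derive_jac.
rewrite -WE; apply: jac_grad_sym.
  by apply: filterS (near_U Ux) => y /DTH_genfun_generating[].
apply: near_eq_differentiable (differentiable_col_mx dP dQ).
by apply: filterS nE => y.
Qed.

Lemma vertices_preserve_form x : U x ->
  let A := jac (start_vertex P) x in let B := jac (end_vertex Q) x in
  A^T *m Jmx m *m A = B^T *m Jmx m *m B.
Proof.
move=> Ux; rewrite /= (jac_start_vertex PC)// (jac_end_vertex QC)//.
exact: sym_block_preserve_Jmx (jac_vertices_sym Ux).
Qed.

Lemma DTH_symplectic : symplectic_transformation U Q P.
Proof.
move=> x Ux A B; split; first exact: vertices_preserve_form.
move=> Au.
have [g [gf fg]] := inverse_function Uo Ux (C1_on_start_vertex Uo PC) Au.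
(* The map sends z_a back to x by the local inverse [g] of the start vertex, then on to z_b. *)
exists (end_vertex Q \o g); split.
  by apply: filterS gf => y; rewrite /= => ->.
apply: filterS (nbhs_interior fg) => w wI.
have [Ug fgw dg] := nbhs_singleton wI.
have ds := differentiable_start_vertex PC Ug.
have de := differentiable_end_vertex QC Ug.
split; first exact: differentiable_comp.
have Ag : jac (start_vertex P) (g w) *m jac g w = 1%:M.
  rewrite -jac_comp// -[RHS](jac_id w); apply: near_eq_jac.
  by apply: filterS wI => v [].
rewrite /symplectic_mx jac_comp// trmx_mul.
(* With A, B the Jacobians of the two vertices at [g w] and G that of [g] at [w], G^T B^T J B G =
   G^T A^T J A G = J, because A G = 1. The identity of forms is taken at [g w], so it covers every
   [w] near the start vertex. *)
have form := vertices_preserve_form Ug; rewrite /= in form.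
rewrite -(mulmxA _ _ (Jmx m)) (mulmxA _ (jac (end_vertex Q) _)).
rewrite -(mulmxA _ (_ *m Jmx m)) -form -!mulmxA Ag mulmx1 !mulmxA.
by rewrite -trmx_mul Ag trmx1 mul1mx.
Qed.

End Step.

Lemma grad_submxP (R : realType) m (S : 'cV[R]_(m + m) -> R) x
    (p q : 'cV[R]_m) :
  usubmx (grad S x) = p -> dsubmx (grad S x) = q -> grad S x = col_mx p q.
Proof. by move=> <- <-; rewrite vsubmxK. Qed.

Lemma gradD (R : realType) m (f g : 'cV[R]_m -> R) x :
  differentiable f x -> differentiable g x ->
  grad (fun y => f y + g y) x = grad f x + grad g x.
Proof.
move=> df dg; apply/colP => i; rewrite !mxE /partial.
by rewrite deriveD//; exact: diff_derivable.
Qed.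

Lemma gradB (R : realType) m (f g : 'cV[R]_m -> R) x :
  differentiable f x -> differentiable g x ->
  grad (fun y => f y - g y) x = grad f x - grad g x.
Proof.
move=> df dg; apply/colP => i; rewrite !mxE /partial.
by rewrite deriveB//; exact: diff_derivable.
Qed.

Unset Implicit Arguments.

(** The equations are nonlinear and may have several solutions for given (q_k, p_{k+1}); the
    dependent variables therefore enter as a branch of solutions on an open set, passing through the
    given step. *)
Theorem theorem7 (R : realType) (n N : nat)
    (H : R -> 'cV[R]_n -> 'cV[R]_n -> R)
    (b : nat -> bool) (psi_ : nat -> R)
    (z : nat -> 'cV[R]_(n.+1 + n.+1)) (lam mu : nat -> R)
    (H_smooth : of_class_C 3 (ext_ham H))
    (z_traj : regularized_DTH_trajectory b (ext_ham H) psi_ N z)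
    (z_eqs : forall k, (k < N)%N ->
      regularized_DTH_eqs (b k) (ext_ham H) (psi_ k)
        (z k) (z k.+1) (lam k) (mu k))
    (nondegenerate : forall k, (k < N)%N ->
      ~ (mu k = 0 /\ psi (ext_ham H) (midpoint (z k) (z k.+1)) = 0)) :
  forall (k : nat) (U : set 'cV[R]_(n.+1 + n.+1))
         (Q P : 'cV[R]_(n.+1 + n.+1) -> 'cV[R]_n.+1)
         (Lam Mu : 'cV[R]_(n.+1 + n.+1) -> R),
  let x_k := col_mx (usubmx (z k)) (dsubmx (z k.+1)) in
  (k < N)%N ->
  open U -> U x_k -> C1_on U Q -> C1_on U P ->
  start_vertex P x_k = z k -> end_vertex Q x_k = z k.+1 ->
  Lam x_k = lam k -> Mu x_k = mu k ->
  (forall x, U x ->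
     regularized_DTH_eqs (b k) (ext_ham H) (psi_ k)
       (start_vertex P x) (end_vertex Q x) (Lam x) (Mu x)) ->
  [/\ generating_function U
        (DTH_genfun (ext_ham H) (psi_ k) Q P Lam Mu) Q P,
      symplectic_transformation U Q P
    & (* multiplier term mu psi instead of mu (psi - psi_k) *)
      generating_function U (DTH_genfun (ext_ham H) 0 Q P Lam Mu) Q P <->
      (forall x, U x -> differentiable (fun y => psi_ k * Mu y) x /\
                        grad (fun y => psi_ k * Mu y) x = 0)].
Proof.
move=> k U Q P Lam Mu x_k kN Uo Ux_k QC PC _ _ _ _ eqs.
have gen := DTH_genfun_generating H_smooth Uo QC PC eqs.
split; first exact: gen.
  exact: DTH_symplectic H_smooth Uo QC PC eqs.
set S := DTH_genfun _ (psi_ k) _ _ _ _ in gen *.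
set S0 := DTH_genfun _ 0 _ _ _ _.
(* The two candidates differ by [psi_ k * Mu y]. As the gradient of [S] is already (P, Q), the other
   one generates exactly when this difference is differentiable with zero gradient. *)
have S0E : S0 = (fun y => S y + psi_ k * Mu y).
  by apply/funext => y; rewrite /S0 /S /DTH_genfun /lagrangian; ring.
have MuE : (fun y => psi_ k * Mu y) = (fun y => S0 y - S y).
  by rewrite S0E; apply/funext => y; rewrite addrC addKr.
split=> [gen0 x Ux|dMu x Ux].
  have [d0 P0 Q0] := gen0 x Ux; have [dS PS QS] := gen x Ux.
  rewrite MuE; split; first exact: differentiableB.
  by rewrite gradB// (grad_submxP P0 Q0) (grad_submxP PS QS) subrr.
have [dM gM] := dMu x Ux; have [dS PS QS] := gen x Ux.
rewrite S0E.
have -> : grad (fun y => S y + psi_ k * Mu y) x = col_mx (P x) (Q x).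
  by rewrite gradD// gM addr0; exact: grad_submxP.
by split; [exact: differentiableD|rewrite col_mxKu|rewrite col_mxKd].
Qed.
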